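(* Let $\phi_1:\mathbb{R}_+\to\mathbb{R}_+$, $\phi_1(t)=t^p$, where $p>0$, and $\phi_2(t)=\ln t$. Given $L\in\mathcal{L}$, the logarithmic mean reversiblization $C_{p,\ln}$ is $\pi$-reversible, that is, $C_{p,\ln}\in\mathcal{L}(\pi)$, where $C_{p,\ln}:=F_g$ with balancing function $$g(t)=\left(\frac{\phi_1'}{\phi_2'}\right)^{-1}\!\left(\frac{\phi_1(t)-\phi_1(1)}{\phi_2(t)-\phi_2(1)}\right)=\left(\frac{t^p-1}{p\ln t}\right)^{1/p}.$$
   Context: $\mathcal{X}$ is a finite set and $\pi$ is a fixed probability distribution on $\mathcal{X}$ with $\pi(x)>0$ for all $x$. $\mathcal{L}$ is the set of Markov infinitesimal generators on $\mathcal{X}$, i.e. $\mathcal{X}\times\mathcal{X}$ real matrices with non-negative off-diagonal entries and all row sums zero. $\mathcal{L}(\pi)\subseteq\mathcal{L}$ is the set of $\pi$-reversible generators, i.e. those $M$ with $\pi(x)M(x,y)=\pi(y)M(y,x)$ for all $x,y$. The $\pi$-dual $L_\pi$ of $L\in\mathcal{L}$ is the generator with off-diagonal entries $L_\pi(x,y)=\frac{\pi(y)}{\pi(x)}L(y,x)$, $x\neq y$, and diagonal entries such that all row sums are zero. A balancing function is $g:\mathbb{R}_+\to\mathbb{R}_+$ with $g(t)=tg(1/t)$ for $t>0$. Given $L\in\mathcal{L}$ and such $g$, $F_g$ is defined for $x\ne y$ by $$F_g(x,y):=\begin{cases}L(x,y),&L(x,y)=L_\pi(x,y),\\ g(0)L_\pi(x,y),&L(x,y)=0\text{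 and }L_\pi(x,y)>0,\\ g\!\left(\frac{L_\pi(x,y)}{L(x,y)}\right)L(x,y),&\text{otherwise},\end{cases}$$ with diagonal entries such that all row sums are zero. (The value $g(1)$ is not used in this definition; $g(0)$ is understood as $\lim_{t\to0^+}g(t)=0$.) *)

(* Defs.v *)
From HB Require Import structures.
From mathcomp Require Import all_boot all_order all_algebra.
From mathcomp Require Import all_classical all_reals all_analysis.

Set Implicit Arguments.
Unset Strict Implicit.
Unset Printing Implicit Defensive.

Import Order.TTheory GRing.Theory Num.Theory.
Import numFieldNormedType.Exports.

Local Open Scope classical_set_scope.
Local Open Scope ring_scope.

(* Real matrices indexed by a finite set X are functions X -> X -> R. *)

Definition generator (R : realType) (X : finType) (M : X -> X -> R) : Prop :=
  (forall x y, x != y -> 0 <= M x y) /\ (forall x, \sum_y M x y = 0).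

Definition reversible_generator (R : realType) (X : finType) (pi : X -> R)
    (M : X -> X -> R) : Prop :=
  generator M /\ (forall x y, pi x * M x y = pi y * M y x).

(* Keeps the off-diagonal entries of A and replaces the diagonal ones so that
   all row sums vanish. *)
Definition fill_diag (R : realType) (X : finType) (A : X -> X -> R)
    (x y : X) : R :=
  if x == y then - \sum_(z | z != x) A x z else A x y.

Definition dual (R : realType) (X : finType) (pi : X -> R) (L : X -> X -> R)
    : X -> X -> R :=
  fill_diag (fun x y => pi y / pi x * L y x).

(* A function R_+ -> R_+ is a function on R of which only the values on
   nonnegative reals matter. *)
Definition balancing (R : realType) (g : R -> R) : Prop :=
  (forall t, 0 <= t -> 0 <= g t) /\ (forall t, 0 < t -> g t = t * g t^-1).

Definition balanced (R : realType) (X : finType) (pi : X -> R) (g : R -> R)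
    (L : X -> X -> R) : X -> X -> R :=
  let Lpi := dual pi L in
  fill_diag (fun x y =>
    if L x y == Lpi x y then L x y
    else if (L x y == 0) && (0 < Lpi x y) then g 0 * Lpi x y
    else g (Lpi x y / L x y) * L x y).

(* The Cauchy mean of x, y > 0. The inverse is that of the restriction of
   phi1' / phi2' to the positive reals; it takes the junk value 0 outside the
   image of this set. The value x at x = y is the usual convention for means. *)
Definition cauchy_mean (R : realType) (phi1 phi2 : R -> R) (x y : R) : R :=
  if x == y then x
  else 'pinv_(fun=> 0) [set t : R | 0 < t]
         (fun t => derive1 phi1 t / derive1 phi2 t)
         ((phi1 x - phi1 y) / (phi2 x - phi2 y)).

(* g(0) is the limit of g at 0 from the right. *)
Definition log_balancing (R : realType) (p t : R) : R :=
  let g (s : R) := cauchy_mean (fun u : R => u `^ p) (@ln R) s 1 in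
  if t == 0 then lim (g s @[s --> 0^'+]) else g t.

Definition log_reversiblization (R : realType) (X : finType) (pi : X -> R)
    (p : R) (L : X -> X -> R) : X -> X -> R :=
  balanced pi (log_balancing p) L.

(* Main.v *)
Require Import Defs.
From HB Require Import structures.
From mathcomp Require Import all_boot all_order all_algebra.
From mathcomp Require Import all_classical all_reals all_analysis.
From mathcomp Require Import ring lra.
Import Order.TTheory GRing.Theory Num.Theory.
Import numFieldNormedType.Exports.
Local Open Scope classical_set_scope.
Local Open Scope ring_scope.

(** The theorem has a linear-algebra half and a calculus half.

    Detailed balance of F_g follows from the identity g(t) = t g(1/t) alone.
    Off the diagonal, write a = pi(x) L(x,y) and b = pi(y) L(y,x) for the two
    probability flows between x and y, so that L_pi(x,y) / L(x,y) = b / a. When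
    a and b are positive and distinct, the flow of F_g from x to y is g(b/a) a
    and the flow back is g(a/b) b; these are equal because
    g(b/a) = (b/a) g(a/b). When one flow vanishes, both sides are g(0) times
    the other flow, and when a = b both sides are a. This is
    [balanced_reversible], valid for every balancing function.

    It remains to identify the Cauchy mean. For phi1(t) = t^p and
    phi2(t) = ln t, the quotient phi1'/phi2' is t |-> p t^p, a bijection of the
    positive reals with inverse y |-> (y/p)^(1/p). Both phi1 and phi2 are
    strictly increasing, so the quotient of their increments is positive, and
    the inverse takes there the value announced by the closed form
    ([cauchy_mean_powR_ln]). Taking the second argument of the mean equal to 1
    gives g. The balancing identity is then the homogeneity of the mean: the
    factor t = (t^p)^(1/p) enters the p-th root. Near 0 the numerator
    |t^p - 1| is at most 1 while |ln t| tends to infinity, so g tends to 0. *)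

(** * Reversibility from the balancing identity *)

Lemma sum_fill_diag (R : realType) (X : finType) (A : X -> X -> R) (x : X) :
  \sum_y fill_diag A x y = 0.
Proof.
rewrite (bigD1 x) //= /fill_diag eqxx.
rewrite [X in _ + X](eq_bigr (fun z => A x z)) ?addNr // => z.
by rewrite eq_sym => /negbTE ->.
Qed.

Lemma fill_diag_offdiag (R : realType) (X : finType) (A : X -> X -> R)
    (x y : X) : x != y -> fill_diag A x y = A x y.
Proof. by rewrite /fill_diag => /negbTE ->. Qed.

Lemma balanced_reversible (R : realType) (X : finType) (pi : X -> R)
    (g : R -> R) (L : X -> X -> R) :
  (forall x, 0 < pi x) -> balancing g -> generator L ->
  reversible_generator pi (balanced pi g L).
Proof.
move=> pi_gt0 [g_ge0 gE] [L_ge0 _].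
have dualE x y : x != y -> dual pi L x y = pi y / pi x * L y x.
  by move=> xy; rewrite /dual fill_diag_offdiag.
have dual_ge0 x y : x != y -> 0 <= dual pi L x y.
  move=> xy; rewrite dualE // mulr_ge0 ?L_ge0 1?eq_sym //.
  by rewrite divr_ge0 // ltW.
split; first split.
- move=> x y xy; rewrite /balanced fill_diag_offdiag //.
  case: ifP => _; first exact: L_ge0.
  case: ifP => _; first by rewrite mulr_ge0 ?g_ge0 ?dual_ge0.
  by rewrite mulr_ge0 ?g_ge0 ?L_ge0 // divr_ge0 ?L_ge0 ?dual_ge0.
- by move=> x; exact: sum_fill_diag.
move=> x y; have [->//|xy] := eqVneq x y.
have yx : y != x by rewrite eq_sym.
rewrite /balanced !fill_diag_offdiag // !dualE //.
have := L_ge0 _ _ xy; have := L_ge0 _ _ yx.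
move: (L x y) (L y x) (pi x) (pi y) (pi_gt0 x) (pi_gt0 y).
move=> a b u v u0 v0 b_ge0 a_ge0.
have un : u != 0 by rewrite gt_eqF.
have vn : v != 0 by rewrite gt_eqF.
(* the two tests for equality with the dual both compare the flows *)
have E1 : (a == v / u * b) = (u * a == v * b).
  by rewrite -(inj_eq (mulfI un)); congr (_ == _); field.
have E2 : (b == u / v * a) = (u * a == v * b).
  by rewrite -(inj_eq (mulfI vn)) eq_sym; congr (_ == _); field.
rewrite E1 E2; case: eqP => // /eqP neq.
have [a0|an] := eqVneq a 0; have [b0|bn] := eqVneq b 0.
- by move: neq; rewrite a0 b0 !mulr0 eqxx.
- have b_gt0 : 0 < b by rewrite lt_def bn.
  by rewrite a0 /= mulr_gt0 ?divr_gt0 // mulr0 mul0r; field.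
- have a_gt0 : 0 < a by rewrite lt_def an.
  by rewrite b0 /= mulr_gt0 ?divr_gt0 // mulr0 mul0r; field.
have a_gt0 : 0 < a by rewrite lt_def an.
have b_gt0 : 0 < b by rewrite lt_def bn.
rewrite /= gE ?divr_gt0 ?mulr_gt0 ?invr_gt0 //.
have -> : (v / u * b / a)^-1 = u / v * a / b by field; rewrite un vn an bn.
by field; rewrite un an.
Qed.

(** * The Cauchy mean of a power and the logarithm *)

(** Two increasing functions have increments of the same sign. *)
Lemma powR_ln_increments_gt0 (R : realType) (p x y : R) :
  0 < p -> 0 < x -> 0 < y -> x != y ->
  0 < (x `^ p - y `^ p) / (ln x - ln y).
Proof.
move=> p_gt0; wlog lt_yx : x y / y < x => [hwlog x0 y0 xy|x0 y0 _].
  have [yx|le_xy] := ltP y x; first exact: hwlog.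
  rewrite -[_ - y `^ p]opprB -[_ - ln y]opprB invrN mulrNN.
  by apply: hwlog; rewrite // 1?eq_sym // lt_def eq_sym xy.
rewrite divr_gt0 // subr_gt0; first by rewrite gt0_ltr_powR ?nnegrE ?ltW.
by rewrite ltr_ln.
Qed.

(** The quotient of increments has to be positive for the partial inverse to
    be meaningful there: exactly the positive reals are values of p t^p. *)
Lemma cauchy_mean_powR_ln (R : realType) (p x y : R) :
  0 < p -> 0 < x -> 0 < y -> x != y ->
  cauchy_mean (fun u => u `^ p) (@ln R) x y =
  ((x `^ p - y `^ p) / (p * (ln x - ln y))) `^ p^-1.
Proof.
move=> p_gt0 x0 y0 xy; rewrite /cauchy_mean (negbTE xy).
set f := (fun t => _ / _); set A := [set t : R | 0 < t].
have pn : p != 0 by rewrite gt_eqF.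
have fE t : 0 < t -> f t = p * t `^ p.
  move=> t0; rewrite /f !derive1E.
  have [_ ->] := is_derive1_powR p t0; have [_ ->] := is_derive1_ln t0.
  rewrite invrK -mulrA; congr (_ * _).
  by rewrite -{2}[t]powRr1 ?ltW // -powRD ?subrK // gt_eqF ?implybT.
have fK t : 0 < t -> (f t / p) `^ p^-1 = t.
  by move=> t0; rewrite fE // mulrAC mulfV // mul1r -powRrM mulfV // powRr1 ?ltW.
have f_inj : {in A &, injective f}.
  by move=> s t; rewrite !inE => s0 t0 st; rewrite -(fK s) // st fK.
have r0 : 0 < (x `^ p - y `^ p) / (ln x - ln y) by exact: powR_ln_increments_gt0.
have -> : (x `^ p - y `^ p) / (p * (ln x - ln y)) =
          (x `^ p - y `^ p) / (ln x - ln y) / p.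
  by rewrite invfM mulrCA mulrC.
move: (_ / (ln x - ln y)) r0 => r r0.
set s := (r / p) `^ p^-1.
have s0 : 0 < s by rewrite powR_gt0 ?divr_gt0.
have <- : f s = r.
  by rewrite fE // -powRrM mulVf // powRr1 ?ltW ?divr_gt0 // mulrC divfK.
by rewrite pinvKV // inE.
Qed.

(** * The logarithmic balancing function *)

Lemma log_balancingE (R : realType) (p t : R) : 0 < p -> 0 < t -> t != 1 ->
  log_balancing p t = ((t `^ p - 1) / (p * ln t)) `^ p^-1.
Proof.
move=> p_gt0 t0 t1; rewrite /log_balancing gt_eqF // cauchy_mean_powR_ln //.
by rewrite ln1 subr0 powR1.
Qed.

Lemma log_balancing1 (R : realType) (p : R) : log_balancing p 1 = 1.
Proof. by rewrite /log_balancing oner_eq0 /cauchy_mean eqxx. Qed.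

Lemma log_balancing_gt0 (R : realType) (p t : R) : 0 < p -> 0 < t ->
  0 < log_balancing p t.
Proof.
move=> p_gt0 t0; have [->|t1] := eqVneq t 1; first by rewrite log_balancing1.
rewrite log_balancingE // powR_gt0 // invfM mulrCA mulr_gt0 ?invr_gt0 //.
by have := powR_ln_increments_gt0 R p t 1 p_gt0 t0 ltr01 t1; rewrite ln1 subr0 powR1.
Qed.

Lemma log_balancing_cvg0 (R : realType) (p : R) : 0 < p ->
  log_balancing p t @[t --> 0^'+] --> (0 : R).
Proof.
move=> p_gt0; apply/cvgrPdist_lt => e e0.
have c0 : 0 < (p * e `^ p)^-1 by rewrite invr_gt0 mulr_gt0 ?powR_gt0.
(* below this bound, - ln t > (p e^p)^-1, hence g(t)^p <= (- p ln t)^-1 < e^p *)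
near=> t.
have t0 : 0 < t by near: t; exact: nbhs_right_gt.
have lnt : ln t < - (p * e `^ p)^-1.
  rewrite -[ltRHS]expRK ltr_ln ?posrE ?expR_gt0 //.
  by near: t; apply: nbhs_right_lt; exact: expR_gt0.
have lnt0 : 0 < - ln t by lra.
have t1 : t != 1 by apply: contraTneq lnt0 => ->; rewrite ln1 oppr0 ltxx.
rewrite sub0r normrN gtr0_norm ?log_balancing_gt0 //.
rewrite log_balancingE //.
have -> : (t `^ p - 1) / (p * ln t) = (1 - t `^ p) / (p * - ln t).
  by rewrite mulrN invrN mulrN -mulNr opprB.
have d0 : 0 < p * - ln t by rewrite mulr_gt0.
have tp1 : t `^ p <= 1.
  have -> : 1 = 1 `^ p by rewrite powR1.
  by rewrite ge0_ler_powR ?nnegrE ?ltW // -ltr_ln ?posrE // ln1; lra.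
have -> : e = (e `^ p) `^ p^-1.
  by rewrite -powRrM mulfV ?gt_eqF // powRr1 ?ltW.
rewrite gt0_ltr_powR ?invr_gt0 ?nnegrE ?powR_ge0 //.
  by rewrite divr_ge0 ?subr_ge0 // ltW.
rewrite ltr_pdivrMr // (@le_lt_trans _ _ 1) ?gerBl ?powR_ge0 //.
rewrite mulrA -ltr_pdivrMl ?mulr_gt0 ?powR_gt0 // mulr1 [e `^ p * p]mulrC.
by lra.
Unshelve. all: by end_near. Qed.

Lemma log_balancing0 (R : realType) (p : R) : 0 < p -> log_balancing p 0 = 0.
Proof.
move=> p_gt0; rewrite {1}/log_balancing eqxx; apply: cvg_lim => //.
apply: cvg_trans (log_balancing_cvg0 R p p_gt0); apply: near_eq_cvg.
by near=> t; rewrite /log_balancing gt_eqF.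
Unshelve. all: by end_near. Qed.

(** The mean M is homogeneous and symmetric, so
    M(t,1) = t M(1,1/t) = t M(1/t,1). *)
Lemma log_balancing_balancing (R : realType) (p : R) : 0 < p ->
  balancing (log_balancing p).
Proof.
move=> p_gt0; split=> t.
  rewrite le_eqVlt => /predU1P[<-|t0]; first by rewrite log_balancing0.
  by rewrite ltW ?log_balancing_gt0.
move=> t0; have [->|t1] := eqVneq t 1.
  by rewrite invr1 log_balancing1 mulr1.
have tV1 : t^-1 != 1 by rewrite invr_eq1.
rewrite !log_balancingE ?invr_gt0 //.
have tE : t = (t `^ p) `^ p^-1.
  by rewrite -powRrM mulfV ?gt_eqF // powRr1 ?ltW.
have lnt : ln t != 0 by rewrite ln_eq0.
have tp : t `^ p != 0 by rewrite gt_eqF ?powR_gt0.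
have tVp : t^-1 `^ p = (t `^ p)^-1.
  by rewrite -(powR_inv1 (ltW t0)) -powRrM mulN1r powRN.
rewrite [X in _ = X * _]tE -powRM ?powR_ge0 //.
  rewrite tVp lnV ?posrE //; congr (_ `^ _).
  by field; rewrite lnt tp gt_eqF.
rewrite invfM mulrCA mulr_ge0 ?invr_ge0 ?ltW //.
have := powR_ln_increments_gt0 R p t^-1 1 p_gt0.
by rewrite ln1 subr0 powR1 => ->; rewrite ?invr_gt0.
Qed.

Theorem theorem4p2 (R : realType) (X : finType) (pi : X -> R)
    (pi_gt0 : forall x, 0 < pi x) (pi_sum1 : \sum_x pi x = 1)
    (p : R) (p_gt0 : 0 < p) (L : X -> X -> R) (L_gen : generator L) :
  [/\ balancing (log_balancing p),
      log_balancing p t @[t --> 0^'+] --> (0 : R),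
      log_balancing p 0 = 0,
      (forall t : R, 0 < t -> t != 1 ->
         log_balancing p t = ((t `^ p - 1) / (p * ln t)) `^ p^-1)
    & reversible_generator pi (log_reversiblization pi p L)].
Proof.
have bal := log_balancing_balancing R p p_gt0.
split=> //.
- exact: log_balancing_cvg0.
- exact: log_balancing0.
- by move=> t; exact: log_balancingE.
- exact: balanced_reversible.
Qed.
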